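(* Let $p=p(m)$ with $m/p\to c\in(0,\infty)$ as $m,p\to\infty$. For each $m$ let $\mathbf{A}_m$ be a deterministic real $m\times p$ matrix with nonnegative entries such that $\frac{1}{mp}\operatorname{tr}(\mathbf{A}_m\mathbf{A}_m^\top)$ is uniformly bounded in $m$. Fix an integer $n\ge 2$ and $\sigma^2>0$, and for $k=1,\dots,n$ let $\tilde{\mathbf{A}}_m^k=\mathbf{A}_m+\sigma\mathbf{E}_m^k$, where $\mathbf{E}_m^1,\dots,\mathbf{E}_m^n$ are independent random $m\times p$ matrices with i.i.d. entries of mean zero, variance one and finite fourth moment. Let $\bar{\mathbf{A}}_m=\frac1n\sum_{k=1}^n\tilde{\mathbf{A}}_m^k$ and let $\mathbf{U}_m$ be the $m\times p$ matrix of all ones. Then, as $m,p\to\infty$ with $m/p\to c$, $$\Big|\tfrac1{mp}\operatorname{tr}(\bar{\mathbf{A}}_{m} \mathbf{U}_{m}^\top)-\tfrac1{mp}\operatorname{tr}(\mathbf{A}_{m} \mathbf{U}_{m}^\top)\Big|\xrightarrow{a.s.}0,\qquad \Big|\tfrac1{mp}\operatorname{tr}(\bar{\mathbf{A}}_{m} \mathbf{A}_{m}^\top)-\tfrac1{mp}\operatorname{tr}(\mathbf{A}_{m} \mathbf{A}_{m}^\top)\Big|\xrightarrow{a.s.}0,$$ $$\Big|\tfrac1{mp}\operatorname{tr}(\bar{\mathbf{A}}_{m} \bar{\mathbf{A}}^\top_{m})-\tfrac1{mp}\operatorname{tr}(\mathbf{A}_{m} \mathbf{A}_{m}^\top)-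\tfrac{\sigma^2}{n}\Big|\xrightarrow{a.s.}0.$$
   Context: The paper writes $\tilde X_{m,p}\overset{a.e.}{\sim}X_{m,p}$ (''asymptotic deterministic equivalent'') to mean $|\tilde X_{m,p}-X_{m,p}|\to0$ almost surely as $m,p\to\infty$ with $m/p\to c\in(0,\infty)$, for a random sequence $\tilde X_{m,p}$ and a deterministic sequence $X_{m,p}$; the claim states the three resulting relations explicitly. *)

(* Defs.v *)
From HB Require Import structures.
From mathcomp Require Import all_boot all_order all_algebra.
From mathcomp Require Import all_classical all_reals all_analysis.
Set Implicit Arguments. Unset Strict Implicit. Unset Printing Implicit Defensive.
Import Order.TTheory GRing.Theory Num.Theory.
Local Open Scope classical_set_scope.
Local Open Scope ring_scope.

(* Mutual independence of a finite family of real random variables: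
   the joint law factorizes on every product of Borel sets
   (taking B i = setT recovers every subfamily). *)
Definition mutually_independent d (T : measurableType d) (R : realType)
  (P : probability T R) (I : finType) (X : I -> T -> R) : Prop :=
  forall B : I -> set R, (forall i, measurable (B i)) ->
    P (\bigcap_(i in [set: I]) (X i @^-1` B i)) =
    (\prod_(i : I) P (X i @^-1` B i))%E.

Definition same_law d (T : measurableType d) (R : realType)
  (P : probability T R) (X Y : T -> R) : Prop :=
  forall B : set R, measurable B -> P (X @^-1` B) = P (Y @^-1` B).

Definition ntr (R : realType) (m q : nat) (M : 'M[R]_m) : R :=
  ((m * q)%:R)^-1 * \tr M.

Definition Abar d (T : measurableType d) (R : realType) (n m q : nat)
  (A : 'M[R]_(m, q)) (sigma : R) (E : 'I_n -> 'I_m -> 'I_q -> T -> R) (w : T)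
  : 'M[R]_(m, q) :=
  (n%:R)^-1 *: \sum_(k < n) (A + sigma *: \matrix_(i, j) E k i j w).

Definition ones (R : realType) (m q : nat) : 'M[R]_(m, q) := const_mx 1.

(* Main.v *)
Require Import Defs.
From HB Require Import structures.
From mathcomp Require Import all_boot all_order all_algebra.
From mathcomp Require Import all_classical all_reals all_analysis.
From mathcomp Require Import measurable_realfun ring lra.
Import Order.TTheory GRing.Theory Num.Theory numFieldNormedType.Exports.
Local Open Scope classical_set_scope.
Local Open Scope ring_scope.

(**
All three errors are fixed linear combinations of averages over the
N = m p(m) positions of pairwise orthogonal square-integrable variables:
a_ij E^k_ij with deterministic weights a, and E^k_ij E^l_ij - [k = l], whose
variance is controlled by the fourth moment. Such an average has second moment
O(1/N) = O(1/m^2) because m/p converges to c > 0, so the second moments are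
summable in m and the averages tend to 0 almost surely.
*)

(** * Vanishing conditional expectations, tested on preimages of Borel sets *)

Section conditional_expectation_zero.
Context {d : measure_display} {T : measurableType d} {R : realType}.
Variable (P : probability T R).
Import HBNNSimple.

(** A simple [h] has finite range, so [h (X w)] is a finite combination of indicators of events of
    [X], and over each of these [G] integrates to 0 within [D]. *)
Lemma integral_comp_nnsfun0 {D : set T} {X G : T -> R} (h : {nnsfun R >-> R}) :
  measurable D -> measurable_fun setT X -> P.-integrable D (EFin \o G) ->
  (forall B, measurable B -> (\int[P]_(w in D `&` X @^-1` B) (G w)%:E = 0)%E) ->
  (\int[P]_(w in D) (h (X w) * G w)%:E = 0)%E.
Proof.
move=> mD mX iG G0.
have mXB B : measurable B -> measurable (X @^-1` B).
  by move=> mB; rewrite -[X in measurable X]setTI; exact: mX.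
have iGr r : P.-integrable D
    (fun w => ((G \_ (X @^-1` (h @^-1` [set r]))) w)%:E).
  have -> : (fun w => ((G \_ (X @^-1` (h @^-1` [set r]))) w)%:E)
          = ((EFin \o G) \_ (X @^-1` (h @^-1` [set r]))).
    by apply/funext => w; rewrite !patchE; case: ifP.
  apply/integrable_restrict; [exact: mXB|by []|].
  by apply: integrableS iG => //; exact/measurableI/mXB.
rewrite (eq_integral (fun w => \sum_(r <- finmap.enum_fset (fset_set (range h)))
    (r%:E * (((G \_ (X @^-1` (h @^-1` [set r]))) w)%:E)))%E); last first.
  move=> w _; rewrite fimfunE fsbig_finite//= mulr_suml -sumEFin.
  apply: eq_bigr => r _; rewrite -EFinM -mulrA; congr (_ * _)%:E.
  by rewrite patchE indicE -[w \in _]/(X w \in h @^-1` [set r]); case: ifP => _;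
    rewrite ?mul1r ?mul0r.
rewrite integral_sum//; last by move=> r; exact: integrableZl.
rewrite big1// => r _; rewrite integralZl// .
rewrite (_ : integral _ _ _ = 0%E) ?mule0//.
rewrite -[RHS](G0 (h @^-1` [set r]))// integral_mkcondr.
by apply: eq_integral => w _; rewrite !patchE; case: ifP.
Qed.

(** Simple functions increase to [phi], and the integrable function [|phi (X w) * G w|] dominates
    every approximation, so dominated convergence carries the zero to the limit. *)
Lemma integral_comp_ge0_0 {D : set T} {X G : T -> R} (phi : R -> R) :
  measurable D -> measurable_fun setT X -> P.-integrable D (EFin \o G) ->
  (forall B, measurable B -> (\int[P]_(w in D `&` X @^-1` B) (G w)%:E = 0)%E) ->
  measurable_fun setT phi -> (forall x, 0 <= phi x) ->
  P.-integrable D (fun w => (phi (X w) * G w)%:E) ->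
  (\int[P]_(w in D) (phi (X w) * G w)%:E = 0)%E.
Proof.
move=> mD mX iG G0 mphi phi0 iphi.
have mphiE : measurable_fun [set: R] (EFin \o phi) by exact/measurable_EFinP.
pose h := nnsfun_approx measurableT mphiE.
have phiE0 x : [set: R] x -> (0 <= (EFin \o phi) x)%E by rewrite /= lee_fin.
have hle n x : h n x <= phi x.
  by rewrite -lee_fin /h nnsfun_approxE; exact: (le_approx _ phiE0).
have [] := @dominated_convergence _ _ _ P _ mD
  (fun n w => (h n (X w) * G w)%:E) (fun w => (phi (X w) * G w)%:E)
  (fun w => `|(phi (X w) * G w)%:E|%E).
- move=> n; apply/measurable_EFinP; apply: measurable_funM.
    by apply: measurable_funTS; apply: measurableT_comp.
  by have /integrableP[/measurable_EFinP] := iG.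
- by have /integrableP[] := iphi.
- apply: aeW => w Dw; under eq_fun do rewrite EFinM; rewrite EFinM.
  by apply: cvgeZr => //; exact: (cvg_nnsfun_approx measurableT mphiE phiE0).
- exact: integrable_abse.
- apply: aeW => w n Dw; rewrite /= lee_fin !normrM ler_wpM2r//.
  by rewrite !ger0_norm.
move=> _ _ /=; rewrite (_ : (fun _ => _) = cst 0%E) => [c|].
  by rewrite -(cvg_lim _ c)// lim_cst.
by apply/funext => n; rewrite (integral_comp_nnsfun0 (h n)).
Qed.

(* If the conditional expectation of [G] given [X] vanishes, then so does [E[X G]]. *)
Lemma integral_mul_preimage0 {D : set T} {X G : T -> R} :
  measurable D -> measurable_fun setT X -> P.-integrable D (EFin \o G) ->
  (forall B, measurable B -> (\int[P]_(w in D `&` X @^-1` B) (G w)%:E = 0)%E) ->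
  P.-integrable D (fun w => (X w * G w)%:E) ->
  (\int[P]_(w in D) (X w * G w)%:E = 0)%E.
Proof.
move=> mD mX iG G0 iXG.
have mG : measurable_fun D G by have /integrableP[/measurable_EFinP] := iG.
(* This is used for the positive and negative parts of the identity; the bound by [|x|] lets them
   inherit integrability from [X * G]. *)
have aux (phi : R -> R) : measurable_fun [set: R] phi -> (forall x, 0 <= phi x) ->
    (forall x, phi x <= `|x|) -> P.-integrable D (fun w => (phi (X w) * G w)%:E) /\
    (\int[P]_(w in D) (phi (X w) * G w)%:E = 0)%E.
  move=> mphi phi0 phile.
  have iphi : P.-integrable D (fun w => (phi (X w) * G w)%:E).
    apply: le_integrable iXG => //.
      apply/measurable_EFinP; apply: measurable_funM => //.
      by apply: measurable_funTS; apply: measurableT_comp.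
    by move=> w Dw; rewrite /= lee_fin !normrM ler_wpM2r// ger0_norm.
  by split=> //; exact: integral_comp_ge0_0.
have mid : measurable_fun [set: R] (@id R) by exact: measurable_id.
have le_sum (x : R) : `|x| = (@id R)^\+ x + (@id R)^\- x.
  by rewrite -[RHS]/(((@id R)^\+ + (@id R)^\-) x) funrposDneg.
have [ip zp] := aux _ (measurable_funrpos mid) (fun x => funrpos_ge0 _ x)
  (fun x => ltac:(by rewrite le_sum lerDl funrneg_ge0)).
have [im zm] := aux _ (measurable_funrneg mid) (fun x => funrneg_ge0 _ x)
  (fun x => ltac:(by rewrite le_sum lerDr funrpos_ge0)).
rewrite (eq_integral (fun w => ((@id R)^\+ (X w) * G w)%:E -
    ((@id R)^\- (X w) * G w)%:E)%E); last first.
  move=> w _; rewrite -EFinB -mulrBl; congr (_ * _)%:E.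
  by rewrite -[RHS]/(((@id R)^\+ - (@id R)^\-) (X w)) funrposBneg.
by rewrite integralB// zp zm sube0.
Qed.

End conditional_expectation_zero.

(** * Mutual independence and centred factors *)

Section independence.
Context {d : measure_display} {T : measurableType d} {R : realType}.
Variables (P : probability T R) (I : finType) (X : I -> T -> R).
Hypothesis mX : forall i, measurable_fun setT (X i).
Hypothesis indX : mutually_independent P X.

(** Cylinders stand in for the sigma-algebra generated by the variables outside [s]: adding a
    constraint on one more variable yields a cylinder again, so variables can be treated one at a
    time. *)
Definition cylinder_off (s : seq I) (B : I -> set R) : set T :=
  \bigcap_(i in [set i | i \notin s]) (X i @^-1` B i).

(* Encodes that the conditional expectation of [G] given the [X i] with
   [i \notin s] is zero, tested on cylinders only. *)
Definition centred_off (s : seq I) (G : T -> R) : Prop :=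
  P.-integrable setT (EFin \o G) /\
  forall B, (forall i, measurable (B i)) ->
    (\int[P]_(w in cylinder_off s B) (G w)%:E = 0)%E.

Lemma measurable_cylinder_off s B :
  (forall i, measurable (B i)) -> measurable (cylinder_off s B).
Proof.
move=> mB; apply: fin_bigcap_measurable => [|i _]; first exact: finite_finset.
by rewrite -[X in measurable X]setTI; exact: mX.
Qed.

Lemma cylinder_off_cons y s B C : y \notin s ->
  cylinder_off (y :: s) B `&` X y @^-1` C =
  cylinder_off s (fun i => if i == y then C else B i).
Proof.
move=> ys; apply/seteqP; split => w.
  move=> [sB yC] i /= si; case: eqVneq => [->//|iy].
  by apply: (sB i); rewrite /= inE negb_or iy.
move=> sB; split; last by have := sB y ys; rewrite /= eqxx.
move=> i; rewrite /= inE negb_or => /andP[iy si].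
by have := sB i si; rewrite /= (negPf iy).
Qed.

(** Replacing the constraint at [y] by [C] leaves a full product event, which independence
    factorizes; the choice [C = setT] then identifies the remaining product as the probability of
    the cylinder. *)
Lemma probability_cylinder_offI y B C :
  (forall i, measurable (B i)) -> measurable C ->
  (P (cylinder_off [:: y] B `&` X y @^-1` C) =
   P (cylinder_off [:: y] B) * P (X y @^-1` C))%E.
Proof.
move=> mB mC; pose upd C := fun i => if i == y then C else B i.
have PE C' : measurable C' -> (P (cylinder_off [:: y] B `&` X y @^-1` C') =
    P (X y @^-1` C') * \prod_(i | i != y) P (X i @^-1` B i))%E.
  move=> mC'; rewrite cylinder_off_cons//.
  have -> : cylinder_off [::] (upd C') =
      \bigcap_(i in [set: I]) (X i @^-1` upd C' i).
    by congr bigcap; apply/seteqP; split.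
  rewrite indX; last by move=> i; rewrite /upd; case: ifP.
  rewrite (bigD1 y)//= {1}/upd eqxx; congr (_ * _)%E.
  by apply: eq_bigr => i iy; rewrite /upd (negPf iy).
have := PE setT measurableT; rewrite preimage_setT setIT probability_setT mul1e.
by move=> ->; rewrite PE// muleC.
Qed.

(** The centred indicator [G = 1_D - P(D)] of a cylinder [D] integrates to 0 over every event of
    [X y], by independence. Hence [E[g(X y) G] = 0], and as [g(X y)] has mean zero this says
    [E[g(X y) 1_D] = 0]. *)
Lemma centred_off_single y (g : R -> R) : measurable_fun setT g ->
  P.-integrable setT (EFin \o (g \o X y)) -> (\int[P]_w (g (X y w))%:E = 0)%E ->
  centred_off [:: y] (g \o X y).
Proof.
move=> mg ig g0; split=> // B mB.
set D := cylinder_off _ _.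
have mD : measurable D by exact: measurable_cylinder_off.
pose G w : R := \1_D w - fine (P D).
have PDfin : P D \is a fin_num by exact: fin_num_measure.
have mgX : measurable_fun setT (g \o X y) by exact: measurableT_comp.
have i1 : P.-integrable setT (EFin \o \1_D) by exact: integrable_indic.
have ic : P.-integrable setT (EFin \o cst (fine (P D))).
  exact: finite_measure_integrable_cst.
have iG : P.-integrable setT (EFin \o G) by exact: integrableB i1 ic.
have igX1 : P.-integrable setT (fun w => (g (X y w) * \1_D w)%:E).
  apply: le_integrable ig => //.
    by apply/measurable_EFinP; apply: measurable_funM.
  move=> w _; rewrite /= lee_fin normrM ler_piMr// indicE.
  by case: (_ \in _); rewrite ?normr1 ?normr0.
have igXc : P.-integrable setT (fun w => (fine (P D))%:E * (g (X y w))%:E)%E.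
  exact: integrableZl.
have -> : (\int[P]_(w in D) (g (X y w))%:E = \int[P]_w (g (X y w) * \1_D w)%:E)%E.
  rewrite integral_mkcond; apply: eq_integral => w _.
  by rewrite patchE indicE; case: ifP; rewrite ?mulr1 ?mulr0.
have gXG w : (g (X y w) * G w)%:E =
    ((g (X y w) * \1_D w)%:E - (fine (P D))%:E * (g (X y w))%:E)%E.
  by rewrite -EFinM -EFinB /G mulrBr [fine _ * _]mulrC.
have : (\int[P]_w (g (X y w) * G w)%:E = 0)%E.
  apply: (@integral_mul_preimage0 _ _ _ _ _ (g \o X y)) => //.
    move=> C mC; rewrite setTI comp_preimage.
    have mgC : measurable (g @^-1` C) by rewrite -[X in measurable X]setTI; exact: mg.
    have mXC : measurable (X y @^-1` (g @^-1` C)).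
      by rewrite -[X in measurable X]setTI; exact: mX.
    have iS f : P.-integrable setT f -> P.-integrable (X y @^-1` (g @^-1` C)) f.
      by apply: integrableS.
    under eq_integral do rewrite EFinB.
    rewrite integralB//; [|exact: iS|exact: iS].
    rewrite integral_indic// integral_cst// fineK//.
    rewrite [X in (X - _)%E](_ : _ = P D * P (X y @^-1` (g @^-1` C)))%E; last first.
      exact: probability_cylinder_offI.
    by rewrite subee// fin_numM// fin_num_measure.
  by under eq_fun do rewrite gXG; exact: integrableB.
under eq_integral do rewrite gXG.
by rewrite integralB//= integralZl// g0 mule0 sube0.
Qed.

(** A cylinder off [a :: s] cut by an event of [X a] is a cylinder off [s], where [G] integrates to
    0. So [G] is conditionally centred given [X a], and multiplying by [f (X a)] preserves the
    zero. *)
Lemma centred_off_cons a s (f : R -> R) G : a \notin s -> measurable_fun setT f ->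
  centred_off s G -> P.-integrable setT (fun w => (f (X a w) * G w)%:E) ->
  centred_off (a :: s) (fun w => f (X a w) * G w).
Proof.
move=> sa mf [iG G0] ifG; split=> // B mB.
have mD := measurable_cylinder_off (a :: s) B mB.
apply: (@integral_mul_preimage0 _ _ _ _ _ (f \o X a)) => //.
- exact: measurableT_comp.
- exact: integrableS iG.
- move=> C mC; rewrite comp_preimage cylinder_off_cons//; apply: G0 => i.
  by case: ifP => _ //; rewrite -[X in measurable X]setTI; exact: mf.
- exact: integrableS ifG.
Qed.

Lemma centred_off_integral s G : centred_off s G -> (\int[P]_w (G w)%:E = 0)%E.
Proof.
move=> [_ /(_ (fun=> setT) (fun=> measurableT))].
by rewrite /cylinder_off bigcapT.
Qed.
End independence.

(** * Almost sure convergence from summable second moments *)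

Section second_moment_slln.
Context {d : measure_display} {T : measurableType d} {R : realType}.
Variables (P : probability T R).

Lemma integral_sqr_sum_orthogonal (J : finType) (W : J -> T -> R) :
  (forall i, W i \in Lfun P 2%:E) ->
  (forall i j, i != j -> (\int[P]_w (W i w * W j w)%:E = 0)%E) ->
  (\int[P]_w ((\sum_i W i w) ^+ 2)%:E = \sum_i \int[P]_w (W i w ^+ 2)%:E)%E.
Proof.
move=> LW W0.
have iW i j : P.-integrable setT (fun w => (W i w * W j w)%:E).
  by apply/Lfun1_integrable; exact: Lfun2_mul_Lfun1.
transitivity (\int[P]_w (\sum_i \sum_j (W i w * W j w)%:E))%E.
  apply: eq_integral => w _; rewrite expr2 mulr_suml -sumEFin.
  by apply: eq_bigr => i _; rewrite mulr_sumr -sumEFin.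
rewrite integral_sum//; last by move=> i; exact: integrable_sum.
apply: eq_bigr => i _; rewrite integral_sum// (bigD1 i)//= big1 ?adde0.
  by apply: eq_integral => w _; rewrite expr2.
by move=> j ji; apply: W0; rewrite eq_sym.
Qed.

Lemma nneseries_inv_sqr_le (C : R) : 0 <= C ->
  (\sum_(0 <= k <oo) (C / k.+1%:R ^+ 2)%:E <= (C * 2)%:E)%E.
Proof.
move=> C0; apply: lime_le.
  by apply: is_cvg_nneseries => n _ _; rewrite lee_fin divr_ge0.
apply: nearW => n; rewrite sumEFin lee_fin -mulr_sumr ler_wpM2l//.
(* Telescoping majorant: [k + 2 <= 2 (k + 1)] gives [1/(k+1)^2 <= 2/((k+1)(k+2))], whence the
   constant 2. *)
apply: (@le_trans _ _ (\sum_(0 <= k < n) - 2 * (k.+2%:R^-1 - k.+1%:R^-1))).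
  apply: ler_sum => k _.
  have -> : k.+2%:R = k.+1%:R + 1 :> R by rewrite natr1.
  have : 1 <= k.+1%:R :> R by rewrite ler1n.
  move: k.+1%:R => x x1; have x0 : 0 < x by lra.
  have -> : - 2 * ((x + 1)^-1 - x^-1) = 2 / (x * (x + 1)).
    by field; rewrite !gt_eqF ?addr_gt0.
  by rewrite ler_pdivlMr ?mulr_gt0 ?addr_gt0// mulrC ler_pdivrMr ?exprn_gt0//; nra.
rewrite -mulr_sumr telescope_sumr// invr1.
have : 0 < n.+1%:R^-1 :> R by rewrite invr_gt0.
move: (n.+1%:R^-1) => y y0. lra.
Qed.

(** The series of the squares has finite expectation, hence is finite almost everywhere, and the
    terms of a convergent series tend to 0. *)
Lemma ae_cvg0_sqr (Y : nat -> T -> R) (C : R) : 0 <= C ->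
  (forall n, measurable_fun setT (Y n)) ->
  (forall n, (\int[P]_w (Y n w ^+ 2)%:E <= (C / n.+1%:R ^+ 2)%:E)%E) ->
  {ae P, forall w, Y ^~ w @ \oo --> 0}.
Proof.
move=> C0 mY Yle.
have mY2 n : measurable_fun setT (fun w => (Y n w ^+ 2)%:E).
  by apply/measurable_EFinP; exact: measurable_funX.
pose S w := (\sum_(0 <= n <oo) (Y n w ^+ 2)%:E)%E.
have S0 w : (0 <= S w)%E by rewrite /S; apply: nneseries_ge0 => n *; rewrite lee_fin sqr_ge0.
have iS : P.-integrable setT S.
  apply/integrableP; split.
    by apply: ge0_emeasurable_sum => // n w _ _; rewrite lee_fin sqr_ge0.
  under eq_integral do rewrite gee0_abs ?S0//.
  rewrite integral_nneseries//; last by move=> n w _; rewrite lee_fin sqr_ge0.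
  apply: (@le_lt_trans _ _ (C * 2)%:E); last exact: ltry.
  apply: le_trans (nneseries_inv_sqr_le C C0).
  apply: lee_nneseries => // n _ _; apply: integral_ge0 => w _.
  by rewrite lee_fin sqr_ge0.
apply: filterS (integrable_ae measurableT iS) => w /(_ I) Sfin.
have f0 n : (0 <= (Y n w ^+ 2)%:E)%E by rewrite lee_fin sqr_ge0.
have tail : (\sum_(N <= k <oo) (Y k w ^+ 2)%:E)%E @[N --> \oo] --> 0%E.
  by apply: nneseries_tail_cvg => //; rewrite ltey_eq Sfin.
(* Each term is at most the tail of the series that starts with it. *)
have sq0 : (Y n w ^+ 2)%:E @[n --> \oo] --> 0%E.
  apply: squeeze_cvge (cvg_cst 0%E) tail; apply: nearW => n; rewrite f0/=.
  have := @nneseries_lim_ge R (fun k => (Y k w ^+ 2)%:E) xpredT n n.+1.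
  by rewrite big_nat1; apply=> k _ _.
have /fine_cvgP[_ sq0R] := sq0.
apply/norm_cvg0P.
have : Num.sqrt (Y n w ^+ 2) @[n --> \oo] --> Num.sqrt (0 : R).
  by apply: continuous_cvg sq0R; exact: sqrt_continuous.
by rewrite sqrtr0; under eq_fun do rewrite sqrtr_sqr.
Qed.

(** By orthogonality the average has second moment at most [N^-2 * K N = K / N], and the growth of
    [N] bounds this by [C K / m^2]. *)
Lemma ae_cvg0_mean_orthogonal (J : nat -> finType) (N : nat -> nat)
    (W : forall m, J m -> T -> R) (C K : R) : 0 <= K ->
  (\forall m \near \oo, m%:R ^+ 2 <= C * (N m)%:R) ->
  (forall m i, W m i \in Lfun P 2%:E) ->
  (forall m i j, i != j -> (\int[P]_w (W m i w * W m j w)%:E = 0)%E) ->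
  (forall m, (\sum_i \int[P]_w (W m i w ^+ 2)%:E <= (K * (N m)%:R)%:E)%E) ->
  {ae P, forall w, (fun m => (N m)%:R^-1 * \sum_i W m i w) @ \oo --> 0}.
Proof.
move=> K0 [m0 _ Nge] LW W0 Wle.
(* At the index [maxn m0 1] the growth bound holds with a positive left side, which excludes a
   negative [C]. *)
have C0 : 0 <= C.
  have := Nge (maxn m0 1) (leq_maxl _ _).
  set m := maxn _ _ => le1; have m1 : (1 <= m)%N by exact: leq_maxr.
  have : 0 < C * (N m)%:R by apply: lt_le_trans le1; rewrite exprn_gt0 // ltr0n.
  by case: (leP 0 C) => // C0; rewrite ltNge mulr_le0_ge0 // ltW.
(* The shifted index lies beyond the threshold [m0] and is at least [n + 1], so [C K / m^2] is at
   most the required [C K / (n+1)^2]. *)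
pose Y n w := (N (n + m0.+1)%N)%:R^-1 * \sum_i W (n + m0.+1)%N i w.
have mW m i : measurable_fun setT (W m i).
  by have := LW m i; rewrite inE => /andP[/[!inE]].
have mS m : measurable_fun setT (fun w => \sum_i W m i w) by exact: measurable_sum.
suff : {ae P, forall w, Y ^~ w @ \oo --> 0}.
  apply: filterS => w.
  by rewrite -(cvg_shiftn m0.+1 (fun m => (N m)%:R^-1 * \sum_i W m i w)).
apply: (@ae_cvg0_sqr Y (C * K) (mulr_ge0 C0 K0)).
- by move=> n; apply: measurable_funM => //; exact: measurable_cst.
- move=> n; rewrite /Y; set m := (n + m0.+1)%N.
  have m_gt0 : (0 < m)%N by rewrite /m addnS.
  have mC : m%:R ^+ 2 <= C * (N m)%:R.
    by apply: Nge; rewrite /= /m addnS -addSn leq_addl.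
  have Nm : 0 < (N m)%:R :> R.
    rewrite lt_neqAle ler0n andbT eq_sym; apply/eqP => N0.
    by move: mC; rewrite N0 mulr0 leNgt exprn_gt0 ?ltr0n.
  under eq_integral do rewrite exprMn EFinM.
  rewrite ge0_integralZl//; last 2 first.
  + by apply/measurable_EFinP; exact: measurable_funX.
  + by move=> w _; rewrite lee_fin sqr_ge0.
  rewrite integral_sqr_sum_orthogonal//; last exact: W0.
  apply: (@le_trans _ _ (((N m)%:R^-1 ^+ 2)%:E * (K * (N m)%:R)%:E)%E).
    by rewrite lee_wpmul2l// lee_fin sqr_ge0.
  rewrite -EFinM lee_fin.
  have -> : (N m)%:R^-1 ^+ 2 * (K * (N m)%:R) = K / (N m)%:R by field; rewrite gt_eqF.
  rewrite ler_pdivrMr// mulrAC ler_pdivlMr ?exprn_gt0//.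
  rewrite [leRHS](_ : _ = K * (C * (N m)%:R)); last by ring.
  apply: ler_wpM2l => //; apply: le_trans mC.
  rewrite lerXn2r ?nnegrE// ler_nat /m addnS ltnS leq_addr//.
Qed.

End second_moment_slln.

(** * Square integrability from fourth moments *)

Section moments.
Context {d : measure_display} {T : measurableType d} {R : realType}.
Variables (P : probability T R).

Lemma integral_probability_cst (r : R) : (\int[P]_w r%:E = r%:E)%E.
Proof.
rewrite integral_cst// (_ : _ setT = 1%E) ?mule1//.
exact: probability_setT.
Qed.

Lemma Lfun2P (f : T -> R) : measurable_fun setT f ->
  P.-integrable setT (fun w => (f w ^+ 2)%:E) -> f \in Lfun P 2%:E.
Proof.
move=> mf /integrableP[_ f2]; rewrite inE; apply/andP; split; rewrite inE//=.
rewrite /finite_norm unlock /Lnorm poweR_lty//.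
apply: le_lt_trans f2; rewrite le_eqVlt; apply/orP; left; apply/eqP.
apply: eq_integral => w _ /=; by rewrite powR_mulrn// normrX.
Qed.

(** The pointwise bound [(f g)^2 <= f^4 + g^4] reduces this to the fourth moments. *)
Lemma Lfun2_mul_fourth (f g : T -> R) :
  measurable_fun setT f -> measurable_fun setT g ->
  P.-integrable setT (fun w => (f w ^+ 4)%:E) ->
  P.-integrable setT (fun w => (g w ^+ 4)%:E) ->
  (fun w => f w * g w) \in Lfun P 2%:E.
Proof.
move=> mf mg if4 ig4; have mfg : measurable_fun setT (fun w => f w * g w).
  exact: measurable_funM.
apply: Lfun2P => //.
apply: le_integrable (integrableD measurableT if4 ig4) => //.
  by apply/measurable_EFinP; exact: measurable_funX.
move=> w _; rewrite -EFinD /= lee_fin ger0_norm ?sqr_ge0//.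
apply: le_trans (ler_norm _); nra.
Qed.

Lemma Lfun2_fourth (f : T -> R) : measurable_fun setT f ->
  P.-integrable setT (fun w => (f w ^+ 4)%:E) -> f \in Lfun P 2%:E.
Proof.
move=> mf if4; rewrite (_ : f = (fun w => f w * cst 1 w)).
  apply: Lfun2_mul_fourth => //; rewrite /cst expr1n.
  exact: finite_measure_integrable_cst.
by apply/funext => w; rewrite mulr1.
Qed.

Lemma integrable_mul_Lfun2 (f g : T -> R) : f \in Lfun P 2%:E ->
  g \in Lfun P 2%:E -> P.-integrable setT (fun w => (f w * g w)%:E).
Proof. by move=> Lf Lg; apply/Lfun1_integrable; exact: Lfun2_mul_Lfun1. Qed.

Lemma integrable_Lfun2 (f : T -> R) : f \in Lfun P 2%:E ->
  P.-integrable setT (fun w => (f w)%:E).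
Proof.
move=> Lf; apply/Lfun1_integrable; apply: Lfun_subset12 => //.
exact: fin_num_measure.
Qed.

(** Here [e] stands for the Kronecker delta that centres a product of two noise entries. *)
Lemma integral_sqr_mulB_le (f g : T -> R) (e K : R) : 0 <= e <= 1 ->
  measurable_fun setT f -> measurable_fun setT g ->
  (\int[P]_w (f w ^+ 4)%:E <= K%:E)%E ->
  (\int[P]_w (g w ^+ 4)%:E <= K%:E)%E ->
  (\int[P]_w ((f w * g w - e) ^+ 2)%:E <= (2 * K + 2)%:E)%E.
Proof.
move=> /andP[e0 e1] mf mg fK gK.
have m4 (h : T -> R) : measurable_fun setT h ->
    measurable_fun setT (fun w => (h w ^+ 4)%:E).
  by move=> mh; apply/measurable_EFinP; exact: measurable_funX.
have p4 (h : T -> R) w : (0 <= (h w ^+ 4)%:E)%E by rewrite lee_fin exprn_even_ge0.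
apply: (@le_trans _ _ (\int[P]_w ((f w ^+ 4)%:E + (g w ^+ 4)%:E + (cst 2%:E w)))%E).
  apply: ge0_le_integral => //.
  - by move=> w _; rewrite lee_fin sqr_ge0.
  - apply/measurable_EFinP/measurable_funX/measurable_funB => //.
    exact: measurable_funM.
  - by apply: emeasurable_funD => //; apply: emeasurable_funD; exact: m4.
  - move=> w _; rewrite /cst -!EFinD lee_fin.
    (* The second square gives [(fg - e)^2 <= 2 f^2 g^2 + 2 e^2], the first gives
       [2 f^2 g^2 <= f^4 + g^4], and [e^2 <= 1]. *)
    have := sqr_ge0 (f w ^+ 2 - g w ^+ 2); have := sqr_ge0 (f w * g w + e).
    nra.
have m44 : measurable_fun setT (fun w => ((f w ^+ 4)%:E + (g w ^+ 4)%:E)%E).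
  by apply: emeasurable_funD; exact: m4.
have p44 w : (0 <= (f w ^+ 4)%:E + (g w ^+ 4)%:E)%E by rewrite adde_ge0.
rewrite ge0_integralD//; last by move=> w _; rewrite /cst lee_fin.
rewrite ge0_integralD//; [|exact: m4|exact: m4].
rewrite integral_probability_cst.
rewrite (_ : 2 * K + 2 = K + K + 2); last by ring.
by rewrite !EFinD leeD2r// leeD.
Qed.

End moments.

(** * Orthogonality of products of independent centred variables *)

Section orthogonality.
Context {d : measure_display} {T : measurableType d} {R : realType}.
Variables (P : probability T R) (I : finType) (X : I -> T -> R).
Hypothesis mX : forall i, measurable_fun setT (X i).
Hypothesis indX : mutually_independent P X.
Hypothesis X4 : forall i, P.-integrable setT (fun w => (X i w ^+ 4)%:E).
Hypothesis EX : forall i, (\int[P]_w (X i w)%:E = 0)%E.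

Let LX i : X i \in Lfun P 2%:E. Proof. exact: Lfun2_fourth. Qed.
Let mid : measurable_fun [set: R] (@id R). Proof. exact: measurable_id. Qed.

Lemma centred_off_self y : centred_off P I X [:: y] (X y).
Proof.
apply: (centred_off_single P I X mX indX y id) => //.
exact: (integrable_Lfun2 _ _ (LX y)).
Qed.

Lemma integral_mul2_indep0 x y : x != y -> (\int[P]_w (X x w * X y w)%:E = 0)%E.
Proof.
move=> xy; apply: (centred_off_integral P I X [:: x; y]).
apply: (centred_off_cons P I X mX x [:: y] id) => //.
- by rewrite inE.
- exact: centred_off_self.
- exact: (integrable_mul_Lfun2 _ _ _ (LX x) (LX y)).
Qed.

(** The last factor [X t] is centred given the other variables, and multiplying by [X z], [X y],
    [X x] in turn keeps the integral zero. *)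
Lemma integral_mul4_indep0 x y z t : uniq [:: x; y; z; t] ->
  (\int[P]_w ((X x w * X y w) * (X z w * X t w))%:E = 0)%E.
Proof.
move=> /and4P[x_ y_ z_ _].
have L2 i j : (fun w => X i w * X j w) \in Lfun P 2%:E by exact: Lfun2_mul_fourth.
under eq_integral do rewrite -mulrA.
apply: (centred_off_integral P I X [:: x; y; z; t]).
apply: (centred_off_cons P I X mX x _ id) => //.
  apply: (centred_off_cons P I X mX y _ id) => //.
    apply: (centred_off_cons P I X mX z _ id) => //; first exact: centred_off_self.
    exact: (integrable_mul_Lfun2 _ _ _ (LX z) (LX t)).
  exact: (integrable_mul_Lfun2 _ _ _ (LX y) (L2 z t)).
(* Grouped in pairs, the fourfold product is a product of two square-integrable functions, hence
   integrable. *)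
under eq_fun do rewrite mulrA.
exact: (integrable_mul_Lfun2 _ _ _ (L2 x y) (L2 z t)).
Qed.

(** The unit second moment makes [g (X y)] centred for [g r = r * r - 1], and the factor [g (X x)]
    depends on another variable. *)
Lemma integral_sqrB1_indep0 x y : x != y ->
  (forall i, (\int[P]_w (X i w ^+ 2)%:E = 1)%E) ->
  (\int[P]_w ((X x w * X x w - 1) * (X y w * X y w - 1))%:E = 0)%E.
Proof.
move=> xy X2; pose g (r : R) := r * r - 1.
have mg : measurable_fun [set: R] g.
  by apply: measurable_funB => //; exact: measurable_funM.
have Lg i : (g \o X i) \in Lfun P 2%:E.
  have L2 : (fun w => X i w * X i w) \in Lfun P 2%:E by exact: Lfun2_mul_fourth.
  have h : (1 <= 2%:E :> \bar R)%E by rewrite lee_fin ler1n.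
  exact: ((Lfun_addr_closed P h).2 _ _ L2 (Lfun_cst P (-1) 2)).
apply: (centred_off_integral P I X [:: x; y]).
apply: (centred_off_cons P I X mX x [:: y] g) => //; first by rewrite inE.
  apply: (centred_off_single P I X mX indX y g) => //; first exact: (integrable_Lfun2 _ _ (Lg y)).
  under eq_integral do rewrite /g EFinB -expr2.
  rewrite integralB//; last 2 first.
  - exact: (integrable_mul_Lfun2 _ _ _ (LX y) (LX y)).
  - exact: finite_measure_integrable_cst.
  by rewrite X2 integral_probability_cst subee.
exact: (integrable_mul_Lfun2 _ _ _ (Lg x) (Lg y)).
Qed.
End orthogonality.

(** Both sides are integrals of [x^4] against the distribution of the variable, and the two
    distributions agree on Borel sets. *)
Lemma integral_fourth_same_law (R : realType) (d : measure_display)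
    (T : measurableType d) (P : probability T R) (X Y : {RV P >-> R}) :
  same_law P X Y -> (\int[P]_w (X w ^+ 4)%:E = \int[P]_w (Y w ^+ 4)%:E)%E.
Proof.
move=> XY; pose f (x : R) := (x ^+ 4)%:E.
have mf : measurable_fun [set: R] f.
  by apply/measurable_EFinP; exact: measurable_funX.
have f0 x : (0 <= f x)%E by rewrite lee_fin exprn_even_ge0.
rewrite -(ge0_integral_distribution X mf f0) -(ge0_integral_distribution Y mf f0).
by apply: eq_measure_integral => B mB _; exact: XY.
Qed.

(** * Traces as averages over positions, growth of the dimensions, and the expanded square *)

Lemma ntr_mul_tr (R : realType) (m q : nat) (M N : 'M[R]_(m, q)) :
  ntr q (M *m N^T) = (m * q)%:R^-1 * \sum_(u : 'I_m * 'I_q) M u.1 u.2 * N u.1 u.2.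
Proof.
rewrite /ntr /mxtrace -(pair_bigA _ (fun i j => M i j * N i j))/=.
congr (_ * _); apply: eq_bigr => i _; rewrite mxE.
by apply: eq_bigr => j _; rewrite mxE.
Qed.

Lemma AbarE (R : realType) (d : measure_display) (T : measurableType d)
    (n m q : nat) (A : 'M[R]_(m, q)) (sigma : R)
    (E : 'I_n -> 'I_m -> 'I_q -> T -> R) (w : T) i j : (0 < n)%N ->
  Abar A sigma E w i j = A i j + sigma / n%:R * \sum_k E k i j w.
Proof.
move=> n0; have nn0 : n%:R != 0 :> R by rewrite pnatr_eq0 -lt0n.
rewrite /Abar mxE summxE; under eq_bigr do rewrite !mxE.
rewrite big_split/= sumr_const card_ord -mulr_sumr -[A i j *+ n]mulr_natl.
by rewrite mulrDr mulKf// mulrA [_^-1 * _]mulrC.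
Qed.

Lemma dim_product_growth (R : realType) (p : nat -> nat) (c : R) : 0 < c ->
  (fun m : nat => (m%:R / (p m)%:R : R)) @ \oo --> c ->
  \forall m \near \oo, m%:R ^+ 2 <= 2 * c * (m * p m)%:R.
Proof.
move=> c0 mp.
have c2 : c < 2 * c by lra.
near=> m.
have mpc : m%:R / (p m)%:R < 2 * c by near: m; exact: cvgr_lt mp _ c2.
(* Division by zero yields 0, so a positive ratio rules out [p m = 0]. *)
have mp0 : 0 < m%:R / (p m)%:R :> R by near: m; exact: cvgr_gt mp _ c0.
have p0 : 0 < (p m)%:R :> R.
  rewrite lt_neqAle ler0n andbT eq_sym; apply/eqP => p0.
  by move: mp0; rewrite p0 invr0 mulr0 ltxx.
rewrite natrM expr2 [leRHS]mulrCA ler_wpM2l//.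
by rewrite -ler_pdivrMr// ltW.
Unshelve. all: by end_near. Qed.

(** Centring the [n] diagonal products [e k * e k] by 1 removes [n * s^2 / n^2 = s^2 / n] from the
    square; this is the source of the limit term [sigma^2 / n]. *)
Lemma sqr_add_mean (R : realType) (n : nat) (a s : R) (e : 'I_n -> R) : (0 < n)%N ->
  (a + s / n%:R * \sum_k e k) ^+ 2 =
  a * a + \sum_k 2 * s / n%:R * (a * e k) + s ^+ 2 / n%:R +
  \sum_k \sum_l s ^+ 2 / n%:R ^+ 2 * (e k * e l - (k == l)%:R).
Proof.
move=> n0; have nn0 : n%:R != 0 :> R by rewrite pnatr_eq0 -lt0n.
have -> : \sum_k \sum_l s ^+ 2 / n%:R ^+ 2 * (e k * e l - (k == l)%:R) =
    s ^+ 2 / n%:R ^+ 2 * ((\sum_k e k) ^+ 2 - n%:R).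
  under eq_bigr do rewrite -mulr_sumr sumrB.
  rewrite -mulr_sumr sumrB; congr (_ * (_ - _)).
    by rewrite expr2 mulr_suml; apply: eq_bigr => k _; rewrite mulr_sumr.
  rewrite (eq_bigr (fun=> 1)) ?sumr_const ?card_ord// => k _.
  rewrite (bigD1 k)//= eqxx big1 ?addr0// => l lk.
  by rewrite eq_sym (negPf lk).
rewrite -!mulr_sumr; field.
exact: nn0.
Qed.

Lemma cvg_sum0 (R : realType) (n : nat) (u : 'I_n -> nat -> R) :
  (forall k, u k @ \oo --> 0) -> (fun m => \sum_k u k m) @ \oo --> 0.
Proof.
move=> u0; elim: (index_enum 'I_n) => [|k s IHs].
  by under eq_fun do rewrite big_nil; exact: cvg_cst.
under eq_fun do rewrite big_cons.
by have := cvgD (u0 k) IHs; rewrite addr0; exact.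
Qed.

(** * Almost sure convergence of the noise averages *)

Section noise.
Context {R : realType} {d : measure_display} {T : measurableType d}.
Variables (P : probability T R) (p : nat -> nat) (n : nat) (C : R).
Variable E : forall m : nat, 'I_n -> 'I_m -> 'I_(p m) -> {RV P >-> R}.
Hypothesis growth : \forall m \near \oo, m%:R ^+ 2 <= C * (m * p m)%:R.
Hypothesis indE : forall m, mutually_independent P
  (fun kij : 'I_n * 'I_m * 'I_(p m) => (E m kij.1.1 kij.1.2 kij.2 : T -> R)).
Hypothesis lawE : forall m m' k k' i i' j j',
  same_law P (E m k i j) (E m' k' i' j').
Hypothesis meanE : forall m k i j, ('E_P[E m k i j] = 0)%E.
Hypothesis varE : forall m k i j, ('V_P[E m k i j] = 1)%E.
Hypothesis fourthE : forall m k i j,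
  P.-integrable setT (EFin \o (fun w => (E m k i j w) ^+ 4)).

Let X m (v : 'I_n * 'I_m * 'I_(p m)) : T -> R := E m v.1.1 v.1.2 v.2.

Let mX m v : measurable_fun setT (X m v).
Proof. exact: measurable_funPT. Qed.

Let X4 m v : P.-integrable setT (fun w => (X m v w ^+ 4)%:E).
Proof. exact: fourthE. Qed.

Let EX m v : (\int[P]_w (X m v w)%:E = 0)%E.
Proof. by have := meanE m v.1.1 v.1.2 v.2; rewrite unlock. Qed.

Let LX m v : X m v \in Lfun P 2%:E.
Proof. exact: Lfun2_fourth. Qed.

Let EX2 m v : (\int[P]_w (X m v w ^+ 2)%:E = 1)%E.
Proof.
have := varE m v.1.1 v.1.2 v.2.
rewrite varianceE; last exact: LX.
by rewrite meanE expe2 mule0 sube0 unlock.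
Qed.

(** Entries at distinct positions are orthogonal, and with unit second moments the summands
    contribute exactly the sum of the squared weights. *)
Lemma ae_cvg0_mean_weighted (a : forall m, 'I_m * 'I_(p m) -> R) (K : R) k :
  (forall m, \sum_u a m u ^+ 2 <= K * (m * p m)%:R) ->
  {ae P, forall w, (fun m => (m * p m)%:R^-1 *
    \sum_u a m u * E m k u.1 u.2 w) @ \oo --> 0}.
Proof.
move=> aK.
have La m u : (fun w => a m u * X m (k, u.1, u.2) w) \in Lfun P 2%:E.
  rewrite (_ : (fun w => _) = a m u \o* X m (k, u.1, u.2)).
    by apply: Lfun_scale => //; rewrite ler1n.
  by apply/funext => w /=; rewrite mulrC.
(* The absolute value of [K] supplies a nonnegative constant, since the sign of [K] is not given. *)
apply: (@ae_cvg0_mean_orthogonal _ _ _ P (fun m => ('I_m * 'I_(p m))%type)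
  (fun m => (m * p m)%N) (fun m u w => a m u * X m (k, u.1, u.2) w) C `|K|) => //.
- move=> m [i j] [i' j'] ij.
  under eq_integral do rewrite mulrACA EFinM.
  rewrite integralZl//; last exact: (integrable_mul_Lfun2 _ _ _ (LX _ _) (LX _ _)).
  rewrite (integral_mul2_indep0 _ _ (X m))// ?mule0//.
  by apply: contra ij => /eqP[-> ->].
- move=> m; rewrite (eq_bigr (fun u => (a m u ^+ 2)%:E)) => [|u _]; last first.
    under eq_integral do rewrite exprMn EFinM.
    rewrite integralZl//; last exact: Lfun2_integrable_sqr (LX _ _).
    by rewrite EX2 mule1.
  rewrite sumEFin lee_fin (le_trans (aK m))// ler_wpM2r//; exact: ler_norm.
Qed.

Lemma fourth_moment_bound : exists2 K : R, 0 <= K &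
  forall m v, (\int[P]_w (X m v w ^+ 4)%:E <= K%:E)%E.
Proof.
(* All entries share one law, so the fourth moment of any single entry serves as [K]; if there is no
   entry at all, 0 does. *)
have [[m [v _]]|noX] := pselect (exists m (v : 'I_n * 'I_m * 'I_(p m)), True).
  exists (fine (\int[P]_w (X m v w ^+ 4)%:E)%E).
    apply: fine_ge0; apply: integral_ge0 => w _.
    by rewrite lee_fin exprn_even_ge0.
  move=> m' v'; rewrite fineK; last exact: (integrable_fin_num _ (X4 m v)).
  by rewrite (integral_fourth_same_law _ _ _ P _ _ 
    (lawE m' m v'.1.1 v.1.1 v'.1.2 v.1.2 v'.2 v.2)).
by exists 0 => // m v; exfalso; apply: noX; exists m, v.
Qed.

Lemma ae_cvg0_mean_product k l :
  {ae P, forall w, (fun m => (m * p m)%:R^-1 *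
    \sum_(u : 'I_m * 'I_(p m)) (E m k u.1 u.2 w * E m l u.1 u.2 w - (k == l)%:R))
    @ \oo --> 0}.
Proof.
have [K K0 KX] := fourth_moment_bound.
have L2 m v v' : (fun w => X m v w * X m v' w) \in Lfun P 2%:E.
  exact: Lfun2_mul_fourth.
apply: (@ae_cvg0_mean_orthogonal _ _ _ P (fun m => ('I_m * 'I_(p m))%type)
  (fun m => (m * p m)%N)
  (fun m u w => X m (k, u.1, u.2) w * X m (l, u.1, u.2) w - (k == l)%:R)
  C (2 * K + 2)) => //.
- by rewrite addr_ge0// mulr_ge0.
- move=> m u; have h : (1 <= 2%:E :> \bar R)%E by rewrite lee_fin ler1n.
  exact: ((Lfun_addr_closed P h).2 _ _ (L2 _ _ _) (Lfun_cst P (- (k == l)%:R) 2)).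
- move=> m [i j] [i' j'] ij.
  (* For [k = l] the summands are centred squares of independent entries. For [k != l] two distinct
     positions involve four distinct entries. *)
  case: eqVneq => [<-|kl].
    apply: (integral_sqrB1_indep0 _ _ (X m)) => //.
    by apply: contra ij => /eqP[-> ->].
  under eq_integral do rewrite !subr0.
  apply: (integral_mul4_indep0 _ _ (X m)) => //=.
  rewrite !inE !xpair_eqE !eqxx !andbT/= (negPf kl) (eq_sym l k) (negPf kl)/=.
  by move: ij; rewrite xpair_eqE => /negPf ->.
- move=> m; apply: (@le_trans _ _
    (\sum_(u : 'I_m * 'I_(p m)) (2 * K + 2)%:E)%E).
    apply: lee_sum => u _; apply: integral_sqr_mulB_le => //.
    by case: (k == l); rewrite !lexx ler01.
  by rewrite sumEFin lee_fin sumr_const card_prod !card_ord mulr_natr.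
Qed.
End noise.

(** * The errors as combinations of noise averages *)

Lemma ntr_Abar_mul_trB (R : realType) (d : measure_display) (T : measurableType d)
    (n m q : nat) (A M : 'M[R]_(m, q)) (sigma : R)
    (E : 'I_n -> 'I_m -> 'I_q -> T -> R) (w : T) : (0 < n)%N ->
  ntr q (Abar A sigma E w *m M^T) - ntr q (A *m M^T) =
  \sum_k sigma / n%:R * ((m * q)%:R^-1 *
    \sum_(u : 'I_m * 'I_q) M u.1 u.2 * E k u.1 u.2 w).
Proof.
move=> n0; rewrite !ntr_mul_tr -mulrBr -sumrB.
rewrite (eq_bigr (fun u : 'I_m * 'I_q =>
    \sum_k sigma / n%:R * (M u.1 u.2 * E k u.1 u.2 w))) => [|u _]; last first.
  rewrite AbarE// mulrDl addrAC subrr add0r -mulrA mulr_suml -mulr_sumr.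
  by congr (_ * _); apply: eq_bigr => k _; rewrite mulrC.
rewrite exchange_big mulr_sumr; apply: eq_bigr => k _.
by rewrite -mulr_sumr mulrCA.
Qed.

(** This averages [sqr_add_mean] over all positions; [0 < m * q] ensures that the constant
    [sigma^2 / n] averages to itself. *)
Lemma ntr_Abar_mul_Abar_trB (R : realType) (d : measure_display)
    (T : measurableType d) (n m q : nat) (A : 'M[R]_(m, q)) (sigma : R)
    (E : 'I_n -> 'I_m -> 'I_q -> T -> R) (w : T) : (0 < n)%N -> (0 < m * q)%N ->
  ntr q (Abar A sigma E w *m (Abar A sigma E w)^T) - ntr q (A *m A^T)
    - sigma ^+ 2 / n%:R =
  \sum_k 2 * sigma / n%:R * ((m * q)%:R^-1 *
    \sum_(u : 'I_m * 'I_q) A u.1 u.2 * E k u.1 u.2 w) +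
  \sum_k \sum_l sigma ^+ 2 / n%:R ^+ 2 * ((m * q)%:R^-1 *
    \sum_(u : 'I_m * 'I_q) (E k u.1 u.2 w * E l u.1 u.2 w - (k == l)%:R)).
Proof.
move=> n0 mq0; have N0 : (m * q)%:R != 0 :> R by rewrite pnatr_eq0 -lt0n.
rewrite !ntr_mul_tr.
rewrite (eq_bigr (fun u : 'I_m * 'I_q => A u.1 u.2 * A u.1 u.2 +
    \sum_k 2 * sigma / n%:R * (A u.1 u.2 * E k u.1 u.2 w) + sigma ^+ 2 / n%:R +
    \sum_k \sum_l sigma ^+ 2 / n%:R ^+ 2 *
      (E k u.1 u.2 w * E l u.1 u.2 w - (k == l)%:R))) => [|u _]; last first.
  by rewrite AbarE// -expr2 sqr_add_mean.
rewrite !big_split/= sumr_const card_prod !card_ord.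
rewrite -[sigma ^+ 2 / n%:R *+ _]mulr_natr !mulrDr [_^-1 * (_ * _%:R)]mulrCA mulVf// mulr1.
rewrite [X in _ = X + _](_ : _ = (m * q)%:R^-1 * \sum_(u : 'I_m * 'I_q)
    \sum_k 2 * sigma / n%:R * (A u.1 u.2 * E k u.1 u.2 w)); last first.
  rewrite [in RHS]exchange_big mulr_sumr; apply: eq_bigr => k _.
  by rewrite -mulr_sumr mulrCA.
rewrite [X in _ = _ + X](_ : _ = (m * q)%:R^-1 * \sum_(u : 'I_m * 'I_q)
    \sum_k \sum_l sigma ^+ 2 / n%:R ^+ 2 *
      (E k u.1 u.2 w * E l u.1 u.2 w - (k == l)%:R)); last first.
  rewrite [in RHS]exchange_big mulr_sumr; apply: eq_bigr => k _.
  rewrite [in RHS]exchange_big mulr_sumr; apply: eq_bigr => l _.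
  by rewrite -mulr_sumr mulrCA.
ring.
Qed.

Lemma sum_sqr_le_ntr (R : realType) (m q : nat) (A : 'M[R]_(m, q)) (B : R) :
  ntr q (A *m A^T) <= B ->
  \sum_(u : 'I_m * 'I_q) A u.1 u.2 ^+ 2 <= B * (m * q)%:R.
Proof.
(* For an empty matrix the normalized trace is 0 by convention and bounds nothing, but the sum of
   squares is empty too. *)
have [mq0|mq0] := posnP (m * q).
  rewrite big1 ?mq0 ?mulr0// => -[i j] _; exfalso.
  by have := leq_mul (leq_ltn_trans (leq0n i) (ltn_ord i))
    (leq_ltn_trans (leq0n j) (ltn_ord j)); rewrite mq0.
by rewrite ntr_mul_tr ler_pdivrMl ?ltr0n// mulrC.
Qed.

(** * Convergence of the three errors *)

Theorem theorem2 (R : realType) (d : measure_display) (T : measurableType d)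
  (P : probability T R)
  (p : nat -> nat) (c : R)
  (A : forall m : nat, 'M[R]_(m, p m))
  (n : nat) (sigma : R)
  (E : forall m : nat, 'I_n -> 'I_m -> 'I_(p m) -> {RV P >-> R}) :
  0 < c ->
  (fun m : nat => (m%:R / (p m)%:R : R)) @ \oo --> c ->
  (forall m (i : 'I_m) (j : 'I_(p m)), 0 <= A m i j) ->
  (exists B : R, forall m, ntr (p m) (A m *m (A m)^T) <= B) ->
  (2 <= n)%N ->
  0 < sigma ^+ 2 ->
  (forall m, mutually_independent P
     (fun kij : 'I_n * 'I_m * 'I_(p m) => (E m kij.1.1 kij.1.2 kij.2 : T -> R))) ->
  (forall m m' k k' i i' j j',
     same_law P (E m k i j) (E m' k' i' j')) ->
  (forall m k i j, ('E_P[E m k i j] = 0)%E) ->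
  (forall m k i j, ('V_P[E m k i j] = 1)%E) ->
  (forall m k i j,
     P.-integrable setT (EFin \o (fun w => (E m k i j w) ^+ 4))) ->
  {ae P, forall w,
     (fun m => `| ntr (p m) (Abar (A m) sigma (fun k i j => E m k i j) w *m (ones R m (p m))^T)
                  - ntr (p m) (A m *m (ones R m (p m))^T) |) @ \oo --> (0 : R)}
  /\
  {ae P, forall w,
     (fun m => `| ntr (p m) (Abar (A m) sigma (fun k i j => E m k i j) w *m (A m)^T)
                  - ntr (p m) (A m *m (A m)^T) |) @ \oo --> (0 : R)}
  /\
  {ae P, forall w,
     (fun m => `| ntr (p m) (Abar (A m) sigma (fun k i j => E m k i j) w
                          *m (Abar (A m) sigma (fun k i j => E m k i j) w)^T)
                  - ntr (p m) (A m *m (A m)^T) - sigma ^+ 2 / n%:R |) @ \oo --> (0 : R)}.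
Proof.
move=> c0 mp _ [B AB] n2 _ indE lawE meanE varE fourthE.
have n0 : (0 < n)%N by exact: ltnW.
have growth := dim_product_growth _ p c c0 mp.
have scale0 (a : R) (u : nat -> R) : u @ \oo --> 0 -> (fun m => a * u m) @ \oo --> 0.
  by move=> u0; rewrite -[X in _ --> X](mulr0 a); apply: cvgMr.
(* Used with the all-ones matrices and with [A]; as [k] has finitely many values, one null set
   serves them all. *)
have weighted (M : forall m, 'M[R]_(m, p m)) (K : R) :
    (forall m, \sum_(u : 'I_m * 'I_(p m)) M m u.1 u.2 ^+ 2 <= K * (m * p m)%:R) ->
    {ae P, forall w, forall k, (fun m => (m * p m)%:R^-1 *
      \sum_(u : 'I_m * 'I_(p m)) M m u.1 u.2 * E m k u.1 u.2 w) @ \oo --> 0}.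
  move=> MK; apply: filter_forall => k.
  exact: (ae_cvg0_mean_weighted P p n _ E growth indE meanE varE fourthE
    (fun m u => M m u.1 u.2) K k MK).
have AK := fun m => sum_sqr_le_ntr _ _ _ (A m) B (AB m).
split; [|split].
- have onesK m : \sum_(u : 'I_m * 'I_(p m)) ones R m (p m) u.1 u.2 ^+ 2 <=
      1 * (m * p m)%:R.
    under eq_bigr do rewrite mxE expr1n.
    by rewrite sumr_const card_prod !card_ord mul1r.
  apply: filterS (weighted _ _ onesK) => w wk; apply/norm_cvg0P.
  under eq_fun do rewrite ntr_Abar_mul_trB//.
  by apply: cvg_sum0 => k; exact/scale0/wk.
- apply: filterS (weighted _ _ AK) => w wk; apply/norm_cvg0P.
  under eq_fun do rewrite ntr_Abar_mul_trB//.
  by apply: cvg_sum0 => k; exact/scale0/wk.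
- have product : {ae P, forall w, forall k l, (fun m => (m * p m)%:R^-1 *
      \sum_(u : 'I_m * 'I_(p m)) (E m k u.1 u.2 w * E m l u.1 u.2 w - (k == l)%:R))
      @ \oo --> 0}.
    apply: filter_forall => k; apply: filter_forall => l.
    exact: (ae_cvg0_mean_product P p n _ E growth indE lawE meanE varE fourthE k l).
  apply: filterS2 (weighted _ _ AK) product => w wk wkl; apply/norm_cvg0P.
  have : (fun m => \sum_k 2 * sigma / n%:R * ((m * p m)%:R^-1 *
      \sum_(u : 'I_m * 'I_(p m)) A m u.1 u.2 * E m k u.1 u.2 w) +
    \sum_k \sum_l sigma ^+ 2 / n%:R ^+ 2 * ((m * p m)%:R^-1 *
      \sum_(u : 'I_m * 'I_(p m))
        (E m k u.1 u.2 w * E m l u.1 u.2 w - (k == l)%:R))) @ \oo --> (0 : R).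
    rewrite -[X in _ --> X]addr0; apply: cvgD.
      by apply: cvg_sum0 => k; exact/scale0/wk.
    by apply: cvg_sum0 => k; apply: cvg_sum0 => l; exact/scale0/wkl.
  (* The error formula requires [0 < m * p m], which the growth bound provides for all large [m], so
     the two sequences agree eventually. *)
  apply: cvg_trans; apply: near_eq_cvg.
  near=> m; rewrite ntr_Abar_mul_Abar_trB//.
  rewrite lt0n; apply/eqP => N0.
  have : m%:R ^+ 2 <= 2 * c * (m * p m)%:R by near: m.
  by rewrite N0 mulr0 leNgt exprn_gt0// ltr0n; near: m; exact: nbhs_infty_gt.
Unshelve. all: by end_near. Qed.
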